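(* Assume that the linear operator $\widehat{\mathcal{L}}:\mathbb{R}^{n\times n}\to\mathbb{R}^{n\times n}$ is invertible and that $\|\widehat{\mathcal{L}}^{-1}\widehat{\Pi}\|<1$ (so that the equation $\widehat{\mathcal{L}}(Y)-\widehat{\Pi}(Y)=\widehat{C}$ has a unique solution $Y^{*}\in\mathbb{R}^{n\times n}$). Then for every initial matrix $Y_0\in\mathbb{R}^{n\times n}$ the preconditioned iteration $$Y_{k+1}=Y_k-\widetilde{\mathcal{P}}^{-1}(\mathcal{R}(Y_k)),\qquad k=0,1,2,\dots,$$ where $\mathcal{R}(Y)=\widehat{\mathcal{L}}(Y)-\widehat{\Pi}(Y)-\widehat{C}$ and $\widetilde{\mathcal{P}}^{-1}=\widehat{\mathcal{L}}^{-1}+\widehat{\mathcal{L}}^{-1}\widehat{\Pi}\,\widehat{\mathcal{L}}^{-1}$, converges linearly to the unique solution $Y^{*}$ of $\widehat{\mathcal{L}}(Y)-\widehat{\Pi}(Y)=\widehat{C}$.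
   Context: Let $n,m\ge 1$, let $A,B\in\mathbb{R}^{n\times n}$ be nonsingular, and let $C,N_i,M_i\in\mathbb{R}^{n\times n}$ for $i=1,\dots,m$. The generalized Sylvester equation is $AX+XB^{T}+\sum_{i=1}^m N_iXM_i^{T}=C$ with unknown $X\in\mathbb{R}^{n\times n}$. Let $A=Q_AH_AQ_A^{T}$ and $B=Q_BH_BQ_B^{T}$ be real Schur decompositions, with $Q_A,Q_B\in\mathbb{R}^{n\times n}$ orthogonal and $H_A,H_B\in\mathbb{R}^{n\times n}$ real block-triangular. Put $\widehat{C}=Q_A^{T}CQ_B$, $\widehat{N}_i=Q_A^{T}N_iQ_A$, $\widehat{M}_i=Q_B^{T}M_iQ_B$. Define the linear operators on $\mathbb{R}^{n\times n}$ $$\widehat{\mathcal{L}}(Y)=H_AY+YH_B^{T},\qquad \widehat{\Pi}(Y)=-\sum_{i=1}^m\widehat{N}_iY\widehat{M}_i^{T}.$$ The transformed generalized Sylvester equation is $H_AY+YH_B^{T}+\sum_{i=1}^m\widehat{N}_iY\widehat{M}_i^{T}=\widehat{C}$, i.e. $\widehat{\mathcal{L}}(Y)-\widehat{\Pi}(Y)=\widehat{C}$. Products of operators denote composition. The symbol $\widetilde{\mathcal{P}}^{-1}$ is just the name of the operator defined in the claim (the first-order truncation of the Neumann series of $(\widehat{\mathcal{L}}-\widehat{\Pi})^{-1}$); it is not asserted to be the inverse of some operator. Here $\|\cdot\|$ is a fixed norm on $\mathbb{R}^{n\times n}$, and for linear operators on $\mathbb{R}^{n\times n}$ it denotes the induced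 operator norm. A sequence $(Y_k)$ converges linearly to $Y^{*}$ if there is $q\in[0,1)$ such that $\|Y_{k+1}-Y^{*}\|\le q\,\|Y_k-Y^{*}\|$ for all $k\ge 0$. *)

(* Defs.v *)
From HB Require Import structures.
From mathcomp Require Import all_boot all_order all_algebra.
From mathcomp Require Import all_classical all_reals all_analysis.

Set Implicit Arguments.
Unset Strict Implicit.
Unset Printing Implicit Defensive.

Import Order.TTheory GRing.Theory Num.Theory.

Local Open Scope classical_set_scope.
Local Open Scope ring_scope.

(* Nonnegativity of N follows from these axioms. *)
Definition is_norm (R : realType) (V : lmodType R) (N : V -> R) : Prop :=
  [/\ forall x y, N (x + y) <= N x + N y,
      forall (a : R) x, N (a *: x) = `|a| * N x
    & forall x, N x = 0 -> x = 0].

(* The supremum is taken in \bar R, so that no boundedness proof is needed for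
   it to be meaningful (the real-valued sup of an unbounded set is 0). *)
Definition op_norm (R : realType) (V : vectType R) (N : V -> R) (F : 'End(V)) :
    \bar R :=
  ereal_sup [set (N (F x))%:E | x in [set x | N x <= 1]].

Definition converges_linearly (R : realType) (V : lmodType R) (N : V -> R)
    (u : nat -> V) (l : V) : Prop :=
  exists2 q : R, 0 <= q < 1 & forall k, N (u k.+1 - l) <= q * N (u k - l).

Definition orthogonal_mx (R : realType) (n : nat) (Q : 'M[R]_n) : Prop :=
  Q^T *m Q = 1%:M.

(* The list s gives the sizes of the consecutive diagonal blocks; the row (or
   column) index i lies in the block number reshape_index s i. *)
Definition real_block_triangular (R : realType) (n : nat) (H : 'M[R]_n) : Prop :=
  exists s : seq nat,
    [/\ all (fun b => 0 < b <= 2)%N s, sumn s = n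
      & forall i j : 'I_n, (reshape_index s j < reshape_index s i)%N ->
          H i j = 0].

Definition real_schur (R : realType) (n : nat) (A Q H : 'M[R]_n) : Prop :=
  [/\ orthogonal_mx Q, real_block_triangular H & A = Q *m H *m Q^T].

Section Operators.
Variables (R : realType) (n m : nat).

Definition sylvester_fun (HA HB Y : 'M[R]_n) : 'M[R]_n :=
  HA *m Y + Y *m HB^T.

Definition bilateral_fun (N M : 'I_m -> 'M[R]_n) (Y : 'M[R]_n) : 'M[R]_n :=
  - \sum_(i < m) N i *m Y *m (M i)^T.

Fact sylvester_fun_is_linear (HA HB : 'M[R]_n) : linear (sylvester_fun HA HB).
Proof.
move=> a X Y; rewrite /sylvester_fun mulmxDr mulmxDl -scalemxAr -scalemxAl.
by rewrite scalerDr addrACA.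
Qed.

HB.instance Definition _ (HA HB : 'M[R]_n) :=
  GRing.isLinear.Build R 'M[R]_n 'M[R]_n _ (sylvester_fun HA HB)
    (sylvester_fun_is_linear HA HB).

Fact bilateral_fun_is_linear (N M : 'I_m -> 'M[R]_n) :
  linear (bilateral_fun N M).
Proof.
move=> a X Y; rewrite /bilateral_fun scalerN -opprD scaler_sumr -big_split /=.
congr (- _); apply: eq_bigr => i _.
by rewrite mulmxDr mulmxDl -scalemxAr -scalemxAl.
Qed.

HB.instance Definition _ (N M : 'I_m -> 'M[R]_n) :=
  GRing.isLinear.Build R 'M[R]_n 'M[R]_n _ (bilateral_fun N M)
    (bilateral_fun_is_linear N M).

Definition sylvester_op (HA HB : 'M[R]_n) : 'End('M[R]_n) :=
  linfun (sylvester_fun HA HB).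

Definition bilateral_op (N M : 'I_m -> 'M[R]_n) : 'End('M[R]_n) :=
  linfun (bilateral_fun N M).

Lemma sylvester_opE (HA HB Y : 'M[R]_n) :
  sylvester_op HA HB Y = HA *m Y + Y *m HB^T.
Proof. by rewrite lfunE. Qed.

Lemma bilateral_opE (N M : 'I_m -> 'M[R]_n) (Y : 'M[R]_n) :
  bilateral_op N M Y = - \sum_(i < m) N i *m Y *m (M i)^T.
Proof. by rewrite lfunE. Qed.

End Operators.

(* inv_lfun (the %VF inverse) is the two-sided inverse of L when L is
   bijective. *)
Definition neumann1 (R : realType) (V : vectType R) (L P : 'End(V)) : 'End(V) :=
  L^-1%VF + (L^-1 \o P \o L^-1)%VF.

Definition residual (R : realType) (V : vectType R) (L P : 'End(V)) (C Y : V) : V :=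
  L Y - P Y - C.

Definition prec_iteration (R : realType) (V : vectType R) (L P : 'End(V))
    (C Y0 : V) (k : nat) : V :=
  iter k (fun Y => Y - neumann1 L P (residual L P C Y)) Y0.

(* Main.v *)
Require Import Defs.
From mathcomp Require Import all_boot all_order all_algebra.
From mathcomp Require Import all_classical all_reals all_analysis.

Import Order.TTheory GRing.Theory Num.Theory.

Local Open Scope ring_scope.

(** Write [T] for [L^-1 \o P].  Since [L - P = L (1 - T)] and
    [neumann1 L P = (1 + T) L^-1], the preconditioned operator telescopes:
      [neumann1 L P (L - P) = (1 + T) (1 - T) = 1 - T^2],
    so one step of the iteration replaces the error [Y - Ystar] by
    [T^2 (Y - Ystar)] ([prec_step_error]).  The operator norm [q < 1] of [T] is a
    Lipschitz constant ([op_norm_lt1_contraction]), hence the error decreases by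
    the factor [q^2 < 1] at each step.

    The same contraction gives the unique solution: a fixed point [x] of [T]
    satisfies [N x <= q * N x], hence vanishes, so [1 - T] is injective, and in
    finite dimension it is then bijective ([contraction_split_solvable]). *)

Section SplitIteration.
Variables (R : realType) (V : vectType R) (N : V -> R).
Hypothesis NP : is_norm N.

Set Implicit Arguments.
Unset Strict Implicit.

Lemma is_norm0 : N 0 = 0.
Proof. by case: NP => _ NZ _; rewrite -(scale0r (0 : V)) NZ normr0 mul0r. Qed.

Lemma is_norm_ge0 x : 0 <= N x.
Proof.
case: NP => ND NZ _; have := ND x (- x).
by rewrite subrr is_norm0 -scaleN1r NZ normrN1 mul1r -mulr2n pmulrn_lge0.
Qed.

(** The supremum over the unit ball is finite because it is below 1, and
    nonnegative because the ball contains 0; homogeneity then spreads the bound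
    from the unit ball to the whole space. *)
Lemma op_norm_lt1_contraction (T : 'End(V)) :
  (op_norm N T < 1)%E ->
  exists2 q : R, 0 <= q < 1 & forall x, N (T x) <= q * N x.
Proof.
move=> T1; have [_ NZ N0] := NP.
have ball x : N x <= 1 -> ((N (T x))%:E <= op_norm N T)%E.
  by move=> Nx; apply: ereal_sup_ubound; exists x.
have op_ge0 : (0 <= op_norm N T)%E.
  by have := ball 0; rewrite linear0 is_norm0; apply; exact: ler01.
case: (op_norm N T) T1 op_ge0 ball => [q| |] //.
rewrite lte_fin lee_fin => q1 q0 ball; exists q; first by rewrite q0.
move=> x; have [/N0 ->|Nx] := eqVneq (N x) 0.
  by rewrite linear0 is_norm0 mulr0.
have Nx_gt0 : 0 < N x by rewrite lt_def Nx is_norm_ge0.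
have normV : `|(N x)^-1| = (N x)^-1 by rewrite ger0_norm ?invr_ge0 ?is_norm_ge0.
have := ball ((N x)^-1 *: x).
rewrite linearZ /= !NZ normV mulVf // lexx lee_fin => /(_ isT).
by rewrite mulrC ler_pdivrMr.
Qed.

Lemma sub_lfunE (f g : 'End(V)) x : (f - g)%R x = f x - g x.
Proof. by rewrite add_lfunE opp_lfunE. Qed.

Lemma contraction_split_solvable (L P : 'End(V)) (q : R) (C : V) :
  lker L == 0%VS -> q < 1 ->
  (forall x, N ((L^-1 \o P)%VF x) <= q * N x) ->
  exists2 Ystar, L Ystar - P Ystar = C & forall Y, L Y - P Y = C -> Y = Ystar.
Proof.
move=> kerL q1 contr; have [_ _ N0] := NP.
have kerD : lker (L - P)%R == 0%VS.
  apply/lker0P/raddf_inj => x.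
  rewrite /= sub_lfunE => /eqP; rewrite subr_eq0 => /eqP LPx.
  (* the kernel of L - P consists of the fixed points of L^-1 \o P *)
  have := contr x; rewrite comp_lfunE -LPx lker0_lfunK // => le_qN.
  apply: N0; apply/eqP; rewrite eq_le is_norm_ge0 andbT.
  have: (1 - q) * N x <= 0 by rewrite mulrBl mul1r subr_le0.
  by rewrite pmulr_rle0 // subr_gt0.
exists ((L - P)%R^-1%VF C); first by rewrite -sub_lfunE lker0_lfunVK.
by move=> Y <-; rewrite -sub_lfunE lker0_lfunK.
Qed.

(** This is the telescoping [1 - (1 + T) (1 - T) = T^2], applied to the error
    after the residual has been rewritten as [(L - P) (Y - Ystar)]. *)
Lemma prec_step_error (L P : 'End(V)) (C Y Ystar : V) :
  lker L == 0%VS -> L Ystar - P Ystar = C ->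
  Y - neumann1 L P (residual L P C Y) - Ystar =
  (L^-1 \o P)%VF ((L^-1 \o P)%VF (Y - Ystar)).
Proof.
move=> kerL <-; set e := Y - Ystar.
have -> : residual L P (L Ystar - P Ystar) Y = L e - P e.
  by rewrite /residual -!sub_lfunE -raddfB.
rewrite addrAC -/e; clearbody e; rewrite /neumann1 add_lfunE !comp_lfunE /=.
rewrite raddfB /= lker0_lfunK // !raddfB /=.
by rewrite [X in _ - X]addrA subrK subKr.
Qed.

Lemma prec_iteration_converges_linearly (L P : 'End(V)) (q : R)
    (C Y0 Ystar : V) :
  lker L == 0%VS -> 0 <= q < 1 ->
  (forall x, N ((L^-1 \o P)%VF x) <= q * N x) ->
  L Ystar - P Ystar = C ->
  converges_linearly N (prec_iteration L P C Y0) Ystar.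
Proof.
move=> kerL /andP[q0 q1] contr solY; exists (q ^+ 2).
  by rewrite exprn_ge0 //= exprn_ilt1.
move=> k; rewrite [prec_iteration _ _ _ _ k.+1]iterS prec_step_error //.
apply: le_trans (contr _) _.
by rewrite expr2 -mulrA ler_wpM2l.
Qed.

End SplitIteration.

Theorem theorem3p5 (R : realType) (n m : nat) (n_gt0 : (0 < n)%N)
    (m_gt0 : (0 < m)%N) (nrm : 'M[R]_n -> R) (nrmP : is_norm nrm)
    (A B C : 'M[R]_n) (N M : 'I_m -> 'M[R]_n)
    (A_unit : A \in unitmx) (B_unit : B \in unitmx)
    (QA HA QB HB : 'M[R]_n)
    (schurA : real_schur A QA HA) (schurB : real_schur B QB HB) :
  let Chat : 'M[R]_n := QA^T *m C *m QB in
  let Nhat := fun i : 'I_m => QA^T *m N i *m QA in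
  let Mhat := fun i : 'I_m => QB^T *m M i *m QB in
  let Lhat := sylvester_op HA HB in
  let Pihat := bilateral_op Nhat Mhat in
  bijective Lhat ->
  (op_norm nrm (Lhat^-1 \o Pihat)%VF < 1)%E ->
  exists Ystar : 'M[R]_n,
    [/\ Lhat Ystar - Pihat Ystar = Chat,
        forall Y : 'M[R]_n, Lhat Y - Pihat Y = Chat -> Y = Ystar
      & forall Y0 : 'M[R]_n,
          converges_linearly nrm (prec_iteration Lhat Pihat Chat Y0) Ystar].
Proof.
move=> Chat Nhat Mhat Lhat Pihat /bij_inj/lker0P kerL opT.
have [q q01 contr] := op_norm_lt1_contraction nrmP opT.
have [_ q1] := andP q01.
have [Ystar solY uniqY] :=
  contraction_split_solvable nrmP Chat kerL q1 contr.
exists Ystar; split=> // Y0.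
exact: prec_iteration_converges_linearly kerL q01 contr solY.
Qed.
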